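(* Let $G$ be a group and $\tau:G\to\mathbb{R}$ a function with small relative defect. Then $G$ is orderable and a left order on $G$ may be defined by declaring $$P=\{g\in G\mid \tau(g)>0\}$$ to be the positive cone of $G$ (i.e., the relation $g<h \iff g^{-1}h\in P$ is the strict part of a left order on $G$ whose positive cone is $P$).
   Context: A left order on a group $G$ is a linear (total) order $\le$ on $G$ such that $g\le h$ implies $fg\le fh$ for all $f,g,h\in G$; its positive cone is $\{g\in G\mid e<g\}$. A group is orderable if it admits a left order. A function $\tau:G\to\mathbb{R}$ on a group $G$ has small relative defect if (i) $\tau(e)=0$, and (ii) for all $g,h\in G$, if $g\ne e$ or $h\neq e$, then $|\tau(g)+\tau(h)-\tau(gh)|<|\tau(g)|+|\tau(h)|$. *)

(* Defs.v *)
From HB Require Import structures.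
From mathcomp Require Import all_boot all_order all_algebra.
From mathcomp Require Import reals.

Set Implicit Arguments.
Unset Strict Implicit.
Unset Printing Implicit Defensive.

Import Order.TTheory GRing.Theory Num.Theory.

Local Open Scope ring_scope.

(* [groupType] covers arbitrary groups, not only finite ones. Its operations live
   in the scope %g, those of the real numbers in %R; in particular [1%g] is the
   identity element of the group. *)

Definition linear_order (T : Type) (le : rel T) : Prop :=
  [/\ reflexive le, antisymmetric le, transitive le & total le].

Definition left_order (G : groupType) (le : rel G) : Prop :=
  linear_order le /\ forall f g h : G, le g h -> le (f * g)%g (f * h)%g.

Definition strict_part (T : eqType) (le : rel T) : rel T :=
  fun x y => (x != y) && le x y.

Definition positive_cone (G : groupType) (le : rel G) : pred G :=
  [pred g | strict_part le 1%g g].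

Definition orderable (G : groupType) : Prop :=
  exists le : rel G, left_order le.

Definition small_relative_defect (R : realType) (G : groupType) (tau : G -> R)
    : Prop :=
  tau 1%g = 0 /\
  forall g h : G, g <> 1%g \/ h <> 1%g ->
    `|tau g + tau h - tau (g * h)%g| < `|tau g| + `|tau h|.

(* Main.v *)
Require Import Defs.
From HB Require Import structures.
From mathcomp Require Import all_boot all_order all_algebra.
From mathcomp Require Import reals.
From mathcomp Require Import lra.

(** A strict bound [|a + b - c| < |a| + |b|] controls signs in two ways.  When
    [c = 0] it is a strict triangle inequality, so [a] and [b] are nonzero of
    opposite signs; when [a] and [b] are both positive it reads
    [|(a + b) - c| < a + b], which forces [c > 0].  Taking [h = g^-1] in the
    small relative defect condition, the first observation gives a positive
    value to [g] or to [g^-1] whenever [g] is not the identity ([srd_total]);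
    the second says that the elements of positive value are closed under
    products ([srd_mul]).  As the identity has value [0], these elements satisfy
    the axioms of a positive cone, and every positive cone defines a left order
    ([cone_le_left_order]). *)

Set Implicit Arguments.
Unset Strict Implicit.
Unset Printing Implicit Defensive.

Import Order.TTheory GRing.Theory Num.Theory.

Local Open Scope ring_scope.

Definition cone_le (G : groupType) (P : pred G) : rel G :=
  fun g h => (g == h) || ((g^-1 * h)%g \in P).

Lemma cone_le_strict (G : groupType) (P : pred G) (P1 : 1%g \notin P) (g h : G) :
  strict_part (cone_le P) g h = ((g^-1 * h)%g \in P).
Proof.
rewrite /strict_part /cone_le; case: eqVneq => [->|//] /=.
by rewrite mulVg (negbTE P1).
Qed.

(** Each axiom of the order is an axiom of the cone applied to quotients
    [g^-1 h]: the product of [g^-1 h] and [h^-1 k] is [g^-1 k], the inverse of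
    [g^-1 h] is [h^-1 g], and [g^-1 h] does not change when [g] and [h] are
    both multiplied by [f] on the left. *)
Lemma cone_le_left_order (G : groupType) (P : pred G)
    (P1 : 1%g \notin P)
    (PM : forall g h, g \in P -> h \in P -> (g * h)%g \in P)
    (PT : forall g, g != 1%g -> (g \in P) || (g^-1%g \in P)) :
  left_order (cone_le P).
Proof.
have PMq g h k : (g^-1 * h)%g \in P -> (h^-1 * k)%g \in P ->
    (g^-1 * k)%g \in P.
  by move=> gh hk; have := PM _ _ gh hk; rewrite -mulgA mulVKg.
split; last first.
  move=> f g h /orP[/eqP->|gh]; first by rewrite /cone_le eqxx.
  by rewrite /cone_le invgM -mulgA mulKg gh orbT.
split.
- by move=> g; rewrite /cone_le eqxx.
- move=> g h /andP[/orP[/eqP//|gh] /orP[/eqP//|hg]].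
  by have := PMq _ _ _ gh hg; rewrite mulVg (negbTE P1).
- move=> h g k /orP[/eqP->//|gh] /orP[/eqP<-|hk].
    by rewrite /cone_le gh orbT.
  by rewrite /cone_le (PMq _ _ _ gh hk) orbT.
- move=> g h; rewrite /cone_le; case: (eqVneq g h) => //= ngh.
  have /PT : (g^-1 * h)%g != 1%g.
    by apply: contra_neq ngh => gh1; rewrite -[h](mulVKg g) gh1 mulg1.
  by rewrite invgM invgK => /orP[->//|->]; rewrite !orbT.
Qed.

Lemma srd_mul (R : realType) (G : groupType) (tau : G -> R)
    (htau : small_relative_defect tau) (g h : G) :
  0 < tau g -> 0 < tau h -> 0 < tau (g * h)%g.
Proof.
case: htau => tau1 tauD g0 h0.
have g1 : g <> 1%g by move=> g1; move: g0; rewrite g1 tau1 ltxx.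
have := tauD g h (or_introl g1).
by rewrite (gtr0_norm g0) (gtr0_norm h0) ltr_norml => /andP[_]; lra.
Qed.

(** If neither value were positive, the triangle inequality for [tau g] and
    [tau g^-1] would be an equality. *)
Lemma srd_total (R : realType) (G : groupType) (tau : G -> R)
    (htau : small_relative_defect tau) (g : G) :
  g != 1%g -> (0 < tau g) || (0 < tau g^-1%g).
Proof.
case: htau => tau1 tauD /eqP g1; have := tauD g g^-1%g (or_introl g1).
rewrite mulgV tau1 subr0; apply: contraTT.
rewrite negb_or -!leNgt => /andP[g0 gV0].
by rewrite (ler0_norm g0) (ler0_norm gV0) ler0_norm; lra.
Qed.

Theorem proposition15 (R : realType) (G : groupType) (tau : G -> R)
    (htau : small_relative_defect tau) :
  let P : pred G := [pred g | 0 < tau g] in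
  orderable G /\
  exists le : rel G,
    [/\ left_order le,
        forall g h : G, strict_part le g h = ((g^-1 * h)%g \in P)
      & positive_cone le =i P].
Proof.
move=> P.
have P1 : 1%g \notin P by rewrite inE (proj1 htau) ltxx.
have leP : left_order (cone_le P).
  apply: cone_le_left_order P1 _ _ => [g h|g]; first exact: srd_mul.
  exact: srd_total.
split; first by exists (cone_le P).
exists (cone_le P); split=> // [g h|g]; first exact: cone_le_strict.
by rewrite [LHS]cone_le_strict // invg1 mul1g.
Qed.
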